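(* Let $t$ be a positive odd integer. Define $$H^{\star}(x;q):= \Big(1-\frac1x\Big)\sum_{n\geq0}\frac{(x^2-1)^nq^{2n^2+n}}{(q^2;q^2)_n(-q;q^2)_{n+1}}+\frac1x\sum_{n\geq0}\frac{(x^2-1)^nq^{2n^2-n}}{(q^2;q^2)_n(-q;q^2)_n}.$$ Then, as formal power series in $q$, $$\sum_{\lambda\in \mathcal{SC}} x^{n_t(\lambda)}\, q^{\vert\lambda\vert} = (-q;q^2)_{\infty}\cdot H^{\star}(x;q^t)\cdot \big((1-x^2)q^{2t};q^{2t}\big)_{\infty}^{(t-1)/2}.$$
   Context: A partition $\lambda=(\lambda_1\ge\lambda_2\ge\dots\ge\lambda_\ell\ge 1)$ has size $|\lambda|=\sum_i\lambda_i$ (the empty partition has size $0$). Its Young diagram has $\lambda_i$ left-justified cells in row $i$. The conjugate $\lambda'$ is the partition whose Young diagram is the reflection of that of $\lambda$ in the main diagonal; $\lambda$ is self-conjugate if $\lambda=\lambda'$, and $\mathcal{SC}$ denotes the set of all self-conjugate partitions (including the empty one). The hook length of the cell $(i,j)$ in the Young diagram of $\lambda$ is the number of cells directly to its right in row $i$, plus the number of cells directly below it in column $j$, plus $1$. For a positive integer $t$, $n_t(\lambda)$ is the number of cells of $\lambda$ whose hook length equals $t$. The $q$-Pochhammer symbol is $(a;q)_0=1$, $(a;q)_n=\prod_{j=0}^{n-1}(1-aq^j)$ for $n\ge1$, and $(a;q)_\infty=\prod_{j\ge0}(1-aq^j)$. *)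

(* Defs.v *)
From mathcomp Require Import all_boot all_order all_algebra.
Set Implicit Arguments. Unset Strict Implicit. Unset Printing Implicit Defensive.
Import GRing.Theory.

(* Rows and columns are 0-indexed: cell (i,j) is in the diagram iff     *)
(* j < nth 0 l i.                                                       *)

Definition is_partition (l : seq nat) : bool :=
  sorted geq l && all (fun k => 0 < k) l.

Definition conj_part (l : seq nat) : seq nat :=
  [seq count (fun r => j < r) l | j <- iota 0 (foldr maxn 0 l)].

Definition self_conjugate (l : seq nat) : bool := conj_part l == l.

Definition hook_length (l : seq nat) (i j : nat) : nat :=
  (nth 0 l i - j.+1) + (nth 0 (conj_part l) j - i.+1) + 1.

Definition n_hook (t : nat) (l : seq nat) : nat :=
  \sum_(i < size l) \sum_(j < nth 0 l i) nat_of_bool (hook_length l i j == t).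

(* Partitions of N are encoded by nonincreasing functions
   f : 'I_N -> 'I_N.+1 of total sum N (the parts, padded with zeros). *)
Definition ffvals N (f : {ffun 'I_N -> 'I_N.+1}) : seq nat :=
  [seq (f i : nat) | i <- enum 'I_N].

Definition posvals N (f : {ffun 'I_N -> 'I_N.+1}) : seq nat :=
  [seq k <- ffvals f | 0 < k].

Definition encodes_partition N (f : {ffun 'I_N -> 'I_N.+1}) : bool :=
  sorted geq (ffvals f) && (sumn (ffvals f) == N).

Local Open Scope ring_scope.

Definition sc_coef (R : nzRingType) (x : R) (t N : nat) : R :=
  \sum_(f : {ffun 'I_N -> 'I_N.+1} |
          encodes_partition f && self_conjugate (posvals f))
     x ^+ n_hook t (posvals f).

Definition fps (R : Type) := nat -> R.

Section FPS.
Variable R : fieldType.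

Definition fps_one : fps R := fun n => (n == 0%N)%:R.
Definition fps_add (f g : fps R) : fps R := fun n => f n + g n.
Definition fps_scale (c : R) (f : fps R) : fps R := fun n => c * f n.
Definition fps_mul (f g : fps R) : fps R :=
  fun n => \sum_(i < n.+1) f i * g (n - i)%N.
Definition fps_pow (f : fps R) (k : nat) : fps R := iter k (fps_mul f) fps_one.
Definition fps_mono (c : R) (k : nat) : fps R := fun n => if n == k then c else 0.

(* multiplicative inverse of a series f with f 0 != 0:
   inv_rev f n = [:: g_n; g_(n-1); ...; g_0 ] where g = f^-1 *)
Fixpoint inv_rev (f : fps R) (n : nat) : seq R :=
  match n with
  | 0 => [:: (f 0%N)^-1]
  | m.+1 => let prev := inv_rev f m in
            (- (f 0%N)^-1 * \sum_(i < m.+1) f i.+1 * nth 0 prev i) :: prev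
  end.
Definition fps_inv (f : fps R) : fps R := fun n => head 0 (inv_rev f n).

Definition fps_subst_pow (t : nat) (f : fps R) : fps R :=
  fun n => if (t %| n)%N then f (n %/ t)%N else 0.

(* infinite sum sum_{n>=0} F n, for a family with F n = O(q^n):
   the coefficient of q^N only involves F 0, ..., F N. *)
Definition fps_infsum (F : nat -> fps R) : fps R :=
  fun N => \sum_(n < N.+1) F n N.

Definition qpoch (a : R) (e s n : nat) : fps R :=
  foldr fps_mul fps_one
    [seq fps_add fps_one (fps_mono (- a) (e + s * j)%N) | j <- iota 0 n].

(* infinite q-Pochhammer symbol (a q^e ; q^s)_oo, for s >= 1:
   factors with j > N do not contribute to the coefficient of q^N. *)
Definition qpoch_inf (a : R) (e s : nat) : fps R :=
  fun N => qpoch a e s N.+1 N.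

Definition Hstar (x : R) : fps R :=
  fps_add
    (fps_scale (1 - x^-1)
       (fps_infsum (fun n =>
          fps_mul (fps_mono ((x ^+ 2 - 1) ^+ n) (2 * n ^ 2 + n)%N)
            (fps_inv (fps_mul (qpoch 1 2 2 n) (qpoch (-1) 1 2 n.+1))))))
    (fps_scale (x^-1)
       (fps_infsum (fun n =>
          fps_mul (fps_mono ((x ^+ 2 - 1) ^+ n) (2 * n ^ 2 - n)%N)
            (fps_inv (fps_mul (qpoch 1 2 2 n) (qpoch (-1) 1 2 n)))))).

End FPS.

(* Main.v *)
(* A self-conjugate partition is determined by the set S of the arm lengths of
   its diagonal cells, an arbitrary finite set of naturals, and its size is
   the sum of 2k+1 over k in S. Read on the symmetric Maya diagram, n_t is
   #{k < t : k, t-1-k in S} + 2 #{k : k not in S, k+t in S}, so for t = 2h+1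
   the generating function is a product over the residue class h and the h
   pairs of classes {i, 2h-i}. Each factor is a weighted count of 0/1 words by
   the number of starts of runs of 1s: one-sided words for the class h, two-sided
   ones for a pair. Both satisfy second-order recurrences, with Q = q^(2t),
     K(z) = (1 + z) K(zQ) + (y - 1) zQ K(zQ^2),   y = x^2,
   solved by sum_n (y-1)^n z^n Q^(n^2) (-zQ^n;Q)_oo / (Q;Q)_n and its variants;
   the first factor yields H*, and a pair, by Euler's identity, yields
   ((1-y)Q;Q)_oo (-z;Q)_oo (-Q/z;Q)_oo.
   To compare the coefficients of q^N one computes modulo q^(N+1), where q is
   nilpotent and all infinite sums and products become finite. *)
Require Import Defs.
From mathcomp Require Import all_boot all_order all_algebra.
From mathcomp Require Import zify ring.
Import GRing.Theory.

Set Implicit Arguments.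
Unset Strict Implicit.
Unset Printing Implicit Defensive.

(** * Self-conjugate partitions as sets of diagonal arm lengths *)

(** Symmetry of the cell relation [j < l i] is self-conjugacy, and it already forces [l] to be
    nonincreasing. *)
Definition sc_shape (M : nat) (l : nat -> nat) : Prop :=
  (forall i, M <= i -> l i = 0) /\ (forall i j, (j < l i) = (i < l j)).

(** Frobenius coordinates: [k] is the arm length of a diagonal cell [(i, i)]. *)
Definition frob (M : nat) (l : nat -> nat) (k : nat) : bool :=
  [exists i : 'I_M, l i == k + i + 1].

Section Shape.
Variables (M : nat) (l : nat -> nat).
Hypothesis lP : sc_shape M l.

Lemma shape_mono i j : i <= j -> l j <= l i.
Proof.
case: lP => _ sym le_ij; rewrite leqNgt; apply/negP => lt_l.
have := sym i (l i); rewrite ltnn => /esym/negbT; rewrite -leqNgt => h1.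
have := sym j (l i); rewrite lt_l => /esym; lia.
Qed.

Lemma shape_le i : l i <= M.
Proof.
case: lP => l0 sym; rewrite leqNgt; apply/negP => h.
by have := sym i M; rewrite h (l0 M (leqnn M)).
Qed.

Lemma frobP k : reflect (exists i, l i = k + i + 1) (frob M l k).
Proof.
case: lP => l0 _; apply: (iffP existsP) => [[i /eqP] | [i li]]; first by exists i.
have iM : i < M by rewrite ltnNge; apply/negP => /l0; lia.
by exists (Ordinal iM); apply/eqP.
Qed.

Lemma frob_lt k : frob M l k -> k < M.
Proof. by move/frobP=> [i li]; have := shape_le i; lia. Qed.

(** Otherwise [l i = k + i + 1] and [l j = j - k] would make [j < l i] equivalent to [l j <= i],
    against symmetry. Hence [M + k] and [M - 1 - k] are never both first-column hook lengths. *)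
Lemma frob_excl k j : frob M l k -> l j + k != j.
Proof.
move/frobP => [i li]; apply/eqP => lj; case: lP => _ sym.
by have := sym i j; case: (ltnP j (l i)); lia.
Qed.

(** The [k] for which row [i] has first-column hook length [M + k] (the row meets the diagonal) or
    [M - 1 - k] (it does not). *)
Let sig_val i := if i < l i then l i - i.+1 else i - l i.

Lemma sig_subproof (i : 'I_M) : sig_val i < M.
Proof. by rewrite /sig_val; have := shape_le i; have := ltn_ord i; case: ifP; lia. Qed.

Let sig (i : 'I_M) : 'I_M := Ordinal (sig_subproof i).

Lemma frob_sig (i : 'I_M) : frob M l (sig i) = (i < l i).
Proof.
rewrite /= /sig_val; case: ltnP => h; first by apply/frobP; exists i; lia.
by apply/idP => fr; have := frob_excl i fr; lia.
Qed.

(** [l i - i] is strictly decreasing, and [frob_sig] tells from the value which case of [sig_val]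
    produced it. *)
Lemma sig_inj : injective sig.
Proof.
move=> i j eq_ij; apply/val_inj => /=.
have /(congr1 val) /= := eq_ij; rewrite /sig_val.
have := frob_sig i; rewrite eq_ij frob_sig.
have [ij | /ltnW ij] := leqP i j; have := shape_mono ij;
  case: (ltnP j (l j)); case: (ltnP i (l i)); lia.
Qed.

(* The first-column hook lengths [l i + M - 1 - i] form the Maya diagram of
   [l] on [0, 2M); by self-conjugacy it contains exactly one of [M + k] and
   [M - 1 - k] for each [k < M]. *)
Lemma beta_reindex (F : nat -> nat) :
  \sum_(i < M) F (l i + (M.-1 - i)) =
  \sum_(k < M) F (if frob M l k then M + k else M.-1 - k).
Proof.
rewrite [RHS](reindex_inj sig_inj); apply: eq_bigr => i _.
rewrite frob_sig /= /sig_val; have := ltn_ord i; have := shape_le i.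
by case: (ltnP i (l i)) => ? ? ?; congr F; lia.
Qed.

(** Each arm [k] replaces [M - 1 - k] by [M + k], a gain of [2k + 1]; the staircase [M - 1 - i]
    cancels. *)
Lemma frob_size : \sum_(i < M) l i = \sum_(k < M) frob M l k * (2 * k + 1).
Proof.
have := beta_reindex id; rewrite big_split /=.
have -> : \sum_(k < M) (if frob M l k then M + k else M.-1 - k) =
  \sum_(k < M) (frob M l k * (2 * k + 1) + (M.-1 - k)).
  by apply: eq_bigr => k _; have := ltn_ord k; case: (frob _ _ _); lia.
by rewrite big_split /= => /eqP; rewrite eqn_add2r => /eqP.
Qed.

End Shape.

Lemma sum_ord_supp (G : nat -> nat) a b :
  (forall k, G k != 0 -> k < a) -> (forall k, G k != 0 -> k < b) ->
  \sum_(k < a) G k = \sum_(k < b) G k.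
Proof.
move=> Ga Gb; suff E c d : (forall k, G k != 0 -> k < c) -> c <= d ->
    \sum_(k < d) G k = \sum_(k < c) G k.
  by rewrite -(E a (maxn a b)) ?leq_maxl // -(E b (maxn a b)) ?leq_maxr.
move=> Gc cd; rewrite -!(big_mkord xpredT) (big_cat_nat (n := c)) //=.
rewrite [X in _ + X]big_nat_cond [X in _ + X]big1 ?addn0 //.
by move=> i /andP[/andP[ci _] _]; apply/eqP; apply: contraTT ci => /Gc; lia.
Qed.

Lemma sum_ord_delta (P : pred nat) M c : (forall k, P k -> k < M) ->
  \sum_(k < M) (P k && (nat_of_ord k == c)) = P c :> nat.
Proof.
move=> PM; case Pc: (P c).
  rewrite (bigD1 (Ordinal (PM _ Pc))) //= Pc eqxx big1 //.
  by move=> i /eqP ne; case: eqP => [e|]; rewrite ?andbF //; case: ne; apply: val_inj.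
by rewrite big1 // => i _; case: eqP => [->|]; rewrite ?Pc ?andbF.
Qed.

Definition hook_stat (t M : nat) (S : pred nat) : nat :=
  \sum_(k < t) (S k && S (t.-1 - k)) + 2 * \sum_(k < M) (~~ S k && S (k + t)).

(** With [b i = l i + (M - 1 - i)] the condition reads [b i + b j = t + 2M - 1]. Values [M + k] and
    [M + k'] satisfy it when [k + k' = t - 1], a mixed pair [M - 1 - k] and [M + k'] when
    [k' = k + t], and two values below [M] never. Mixed pairs occur in both orders, whence the
    factor 2. *)
Lemma frob_hooks M l t : sc_shape M l -> 0 < t ->
  \sum_(i < M) \sum_(j < M) (l i + l j == t + i + j + 1) =
  hook_stat t M (frob M l).
Proof.
move=> lP t0; set S := frob M l; pose be k := if S k then M + k else M.-1 - k.
transitivity (\sum_(k < M) \sum_(k' < M) (be k + be k' == t + 2 * M - 1)).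
  rewrite -(beta_reindex lP
    (fun b => \sum_(k' < M) (b + be k' == t + 2 * M - 1)))%N.
  apply: eq_bigr => i _; rewrite -(beta_reindex lP
    (fun b => (l i + (M.-1 - i) + b == t + 2 * M - 1 : nat)))%N.
  apply: eq_bigr => j _; congr nat_of_bool; have := ltn_ord i; have := ltn_ord j.
  by move=> *; apply/eqP/eqP; lia.
have SM k : S k -> k < M := @frob_lt _ _ lP k.
transitivity (\sum_(k < M) \sum_(k' < M)
   ((S k && (k < t) && (S k' && (nat_of_ord k' == t.-1 - k))) +
    ((~~ S k && (S k' && (nat_of_ord k' == k + t))) +
     (~~ S k' && (S k && (nat_of_ord k == k' + t)))))).
  apply: eq_bigr => k _; apply: eq_bigr => k' _; rewrite /be.
  have := ltn_ord k; have := ltn_ord k'.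
  by case: (S k); case: (S k') => /= *; lia.
rewrite /hook_stat; under eq_bigr do rewrite !big_split /=.
rewrite !big_split /= [X in _ + (_ + X)]exchange_big /= mul2n -addnn.
congr (_ + (_ + _)).
- transitivity (\sum_(k < M) (S k && (k < t) && S (t.-1 - k))).
    apply: eq_bigr => k _; case: (S k && _) => /=; last by rewrite big1.
    exact: (sum_ord_delta _ SM).
  rewrite (@sum_ord_supp (fun k => S k && (k < t) && S (t.-1 - k)) M t).
  + by apply: eq_bigr => k _; rewrite ltn_ord andbT.
  + by move=> k; case Sk: (S k) => //= _; apply: SM.
  + by move=> k; case: (k < t); rewrite ?andbF.
- apply: eq_bigr => k _; case: (S k) => /=; first by rewrite big1.
  exact: (sum_ord_delta _ SM).
- apply: eq_bigr => k _; case: (S k) => /=; first by rewrite big1.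
  exact: (sum_ord_delta _ SM).
Qed.

(** Induction on [M]: if [M] belongs to [S], the diagram is wrapped in a new outermost hook with arm
    and leg [M], which keeps the other diagonal arms. *)
Lemma shape_exists M (S : pred nat) :
  exists l, sc_shape M l /\ forall k, k < M -> frob M l k = S k.
Proof.
elim: M => [|M [l [lP lS]]]; first by exists (fun=> 0); split.
case SM: (S M); last first.
  have lP' : sc_shape M.+1 l.
    by case: lP => l0 sym; split=> // i /ltnW /l0.
  exists l; split=> // k; rewrite ltnS leq_eqVlt => /predU1P [->|kM].
    by rewrite SM; apply/frobP => // -[i li]; have := shape_le lP i; lia.
  by rewrite -lS //; apply/(frobP lP')/(frobP lP).
pose l' i := if i is i'.+1 then if i' < M then (l i').+1 else 0 else M.+1.
have l0 : forall i, M <= i -> l i = 0 by case: lP.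
have lP' : sc_shape M.+1 l'.
  split; first by case=> // i; rewrite ltnS leqNgt /= => /negbTE ->.
  case=> [|i] [|j] //=; rewrite ?ltnS; [by case: (ltnP j M)|by case: (ltnP i M)|].
  case: lP => _ sym; have := sym i j.
  case: (ltnP i M) => iM; case: (ltnP j M) => jM //; rewrite ?ltnS //.
    by rewrite (l0 j) // ltn0.
  by rewrite (l0 i) // ltn0.
exists l'; split=> // k; rewrite ltnS leq_eqVlt => /predU1P [->|kM].
  by rewrite SM; apply/(frobP lP'); exists 0 => /=; lia.
rewrite -lS //; apply/(frobP lP')/(frobP lP) => [[[|i] /=]|[i li]].
- by lia.
- by case: ifP => // _ ?; exists i; lia.
exists i.+1 => /=; case: ltnP => [_|/l0]; lia.
Qed.

(** By [beta_reindex] the set of first-column hook lengths depends only on the arm set; sorted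
    decreasingly, it gives back the rows. *)
Lemma shape_inj M l1 l2 : sc_shape M l1 -> sc_shape M l2 ->
  (forall k, k < M -> frob M l1 k = frob M l2 k) -> l1 =1 l2.
Proof.
move=> P1 P2 eqS.
pose b l := [seq l i + (M.-1 - i) | i <- iota 0 M].
have bs l : sc_shape M l -> sorted gtn (b l).
  move=> lP; rewrite sorted_map; apply: (@sub_in_sorted _ (gtn M) ltn).
  - by move=> i j; rewrite !inE /= => iM jM ij; have := shape_mono lP (ltnW ij); lia.
  - by apply/allP => i; rewrite mem_iota.
  - exact: iota_ltn_sorted.
have bm l c : sc_shape M l ->
  count_mem c (b l) = \sum_(k < M) ((if frob M l k then M + k else M.-1 - k) == c).
  move=> lP; rewrite -(beta_reindex lP (fun b => b == c : nat)).
  rewrite count_map -sum1_count big_mkcond -[X in iota 0 X]subn0.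
  by rewrite -/(index_iota 0 M) big_mkord; apply: eq_bigr => i _ /=; case: eqP.
have eqb : b l1 = b l2.
  apply: (@irr_sorted_eq _ gtn).
  - by move=> x y z /= h1 h2; apply: ltn_trans h2 h1.
  - by move=> x /=; rewrite ltnn.
  - exact: bs.
  - exact: bs.
  move=> c; rewrite -!has_pred1 !has_count !bm //; congr (0 < _).
  by apply: eq_bigr => k _; rewrite eqS.
move=> i; case: (ltnP i M) => iM; last by case: P1 => -> // _; case: P2 => ->.
have /(congr1 (fun s => nth 0 s i)) := eqb.
by rewrite !(nth_map 0) ?size_iota // nth_iota // add0n => /addIn.
Qed.

(** * Lists of parts padded with zeros, and their conjugates *)

Lemma ltn_count_sorted s i j : sorted geq s ->
  (i < count (fun r => j < r) s) = (j < nth 0 s i).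
Proof.
elim: s i => [|a s IH] i //=; first by rewrite nth_nil.
rewrite path_sortedE; last by move=> x y z /= h1 h2; apply: leq_trans h2 h1.
case/andP=> /allP ge_a srt; case: i => [|i] /=.
  case: (ltnP j a) => //= aj; rewrite -has_count; apply/negP => /hasP [r /ge_a /=]; lia.
case: (ltnP j a) => [ja|aj]; first by rewrite add1n ltnS IH.
rewrite add0n; have -> : count (fun r => j < r) s = 0.
  by apply/eqP; rewrite -leqn0 leqNgt -has_count; apply/negP => /hasP [r /ge_a /=]; lia.
case: (ltnP i (size s)) => iM; last by rewrite nth_default.
by have := ge_a _ (mem_nth 0 iM); rewrite /=; lia.
Qed.

Lemma nth_conj_part s j : nth 0 (conj_part s) j = count (fun r => j < r) s.
Proof.
have mx r : r \in s -> r <= foldr maxn 0 s.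
  elim: s => //= a s IH; rewrite inE => /predU1P [->|/IH]; first exact: leq_maxl.
  by move/leq_trans; apply; apply: leq_maxr.
rewrite /conj_part; case: (ltnP j (foldr maxn 0 s)) => h.
  by rewrite (nth_map 0) ?size_iota // nth_iota.
rewrite nth_default ?size_map ?size_iota //; apply/esym/eqP.
by rewrite -leqn0 leqNgt -has_count; apply/negP => /hasP [r /mx]; lia.
Qed.

Lemma eq_nat_lt a b : (forall i, (i < a) = (i < b)) -> a = b.
Proof.
by move=> h; have := h a; have := h b; rewrite !ltnn; lia.
Qed.

Section SortedParts.
Variable s : seq nat.
Hypothesis srt : sorted geq s.
Let p := [seq k <- s | 0 < k].

Lemma count_posparts j : count (fun r => j < r) p = count (fun r => j < r) s.
Proof. by rewrite count_filter; apply: eq_count => r /=; lia. Qed.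

Lemma sorted_posparts : sorted geq p.
Proof. by apply: sorted_filter => // x y z /= h1 h2; apply: leq_trans h2 h1. Qed.

Lemma nth_posparts i : nth 0 p i = nth 0 s i.
Proof.
apply: eq_nat_lt => j.
by rewrite -!ltn_count_sorted // ?count_posparts // sorted_posparts.
Qed.

Lemma nth_conj_posparts j i : (i < nth 0 (conj_part p) j) = (j < nth 0 s i).
Proof. by rewrite nth_conj_part count_posparts ltn_count_sorted. Qed.

Lemma self_conjugateP : reflect (forall i j, (j < nth 0 s i) = (i < nth 0 s j))
  (self_conjugate p).
Proof.
apply: (iffP eqP) => [sc i j|sym].
  by rewrite -nth_conj_posparts sc nth_posparts.
have szp : size p = nth 0 s 0.
  by apply: eq_nat_lt => i; rewrite sym -ltn_count_sorted // size_filter.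
apply: (@eq_from_nth _ 0) => [|i _].
  rewrite szp size_map size_iota -nth_posparts; have := sorted_posparts.
  case: (p) => //= a r; rewrite path_sortedE; last first.
    by move=> x y z /= h1 h2; apply: leq_trans h2 h1.
  case/andP=> /allP ge_a _; apply/maxn_idPl.
  elim: r ge_a => //= b r IH ge_a; rewrite geq_max IH ?andbT.
    by apply: (ge_a b); rewrite mem_head.
  by move=> c cr; apply: ge_a; rewrite inE cr orbT.
by rewrite nth_posparts; apply: eq_nat_lt => j; rewrite nth_conj_posparts sym.
Qed.

(** Self-conjugacy turns the leg into a row length. Outside the diagram [l i <= j] and [l j <= i],
    so [l i + l j <= i + j] and the equation fails for [t > 0]; both indices may therefore run
    freely up to [M]. *)
Lemma n_hook_posparts M t : self_conjugate p -> (forall i, M <= i -> nth 0 s i = 0) ->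
  0 < t -> n_hook t p =
  \sum_(i < M) \sum_(j < M) (nth 0 s i + nth 0 s j == t + i + j + 1).
Proof.
move=> sc s0 t0; have /self_conjugateP sym := sc; have /eqP scE := sc.
have lP : sc_shape M (nth 0 s) by split.
have szp : size p = nth 0 s 0.
  by apply: eq_nat_lt => i; rewrite sym -ltn_count_sorted // size_filter.
have inner i : \sum_(j < nth 0 p i) (hook_length p i j == t) =
    \sum_(j < M) (nth 0 s i + nth 0 s j == t + i + j + 1).
  rewrite nth_posparts; pose G j :=
    (nth 0 s i + nth 0 s j == t + i + j + 1) && (j < nth 0 s i) : nat.
  transitivity (\sum_(j < nth 0 s i) G j).
    apply: eq_bigr => j _; congr nat_of_bool.
    rewrite /hook_length scE !nth_posparts ltn_ord andbT.
    have := ltn_ord j; have := sym i j.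
    by move=> *; apply/eqP/eqP; lia.
  rewrite (@sum_ord_supp G _ M).
  - apply: eq_bigr => j _; congr nat_of_bool; have := sym i j.
    by case: (ltnP j (nth 0 s i)); rewrite ?andbT ?andbF // => *; apply/esym/eqP; lia.
  - by move=> k; rewrite /G; case: (k < nth 0 s i); rewrite ?andbF.
  - by move=> k; rewrite /G; case: (ltnP k (nth 0 s i)); rewrite ?andbF // => ? _;
      have := shape_le lP i; lia.
rewrite /n_hook; under eq_bigr do rewrite inner.
rewrite szp; apply: (@sum_ord_supp (fun i =>
  \sum_(j < M) (nth 0 s i + nth 0 s j == t + i + j + 1))) => k.
  apply: contraNT; rewrite -leqNgt => k0; apply/eqP/big1 => j _.
  have := sym k 0; have := sym k j; have := sym k k; have := shape_mono lP (leq0n j).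
  by move=> *; apply/eqP; rewrite eqb0; apply/eqP; lia.
apply: contraNT; rewrite -leqNgt => k0; apply/eqP/big1 => j _.
rewrite s0 //; have := shape_le lP j; have := sym k j; rewrite s0 //.
by move=> *; apply/eqP; rewrite eqb0; apply/eqP; lia.
Qed.

End SortedParts.

(** * Encoded partitions of [N] versus sets of diagonal arms *)

Section Encoding.
Variables (N M : nat).
Hypothesis leNM : N <= M.
Implicit Type f : {ffun 'I_N -> 'I_N.+1}.

Lemma size_ffvals f : size (ffvals f) = N.
Proof. by rewrite size_map -cardT card_ord. Qed.

Lemma nth_ffvals_ge f i : N <= i -> nth 0 (ffvals f) i = 0.
Proof. by move=> Ni; rewrite nth_default ?size_ffvals. Qed.

Lemma nth_ffvals f (i : 'I_N) : nth 0 (ffvals f) i = f i.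
Proof. by rewrite (nth_map i) ?size_enum_ord // nth_ord_enum. Qed.

Lemma sumn_ffvals f : sumn (ffvals f) = \sum_(i < M) nth 0 (ffvals f) i.
Proof.
rewrite sumnE (big_nth 0) size_ffvals big_mkord; apply: sum_ord_supp => k.
  by apply: contraNT; rewrite -leqNgt => /nth_ffvals_ge ->.
by apply: contraNT; rewrite -leqNgt => /(leq_trans leNM)/nth_ffvals_ge ->.
Qed.

Definition sc_code f := encodes_partition f && self_conjugate (posvals f).

Lemma sc_code_shape f : sc_code f -> sc_shape M (nth 0 (ffvals f)).
Proof.
case/andP=> /andP[srt _] /(self_conjugateP srt) sym; split=> // i Mi.
exact/nth_ffvals_ge/(leq_trans leNM).
Qed.

Lemma sc_code_size f : sc_code f ->
  \sum_(k < M) frob M (nth 0 (ffvals f)) k * (2 * k + 1) = N.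
Proof.
move=> sc; rewrite -frob_size; last exact: sc_code_shape.
by case/andP: sc => /andP[_ /eqP sz] _; rewrite -[RHS]sz sumn_ffvals.
Qed.

Lemma sc_code_inj f g : sc_code f -> sc_code g ->
  (forall k, k < M -> frob M (nth 0 (ffvals f)) k = frob M (nth 0 (ffvals g)) k) ->
  f = g.
Proof.
move=> /sc_code_shape Pf /sc_code_shape Pg /(shape_inj Pf Pg) eqfg.
by apply/ffunP => i; apply/val_inj; rewrite /= -!nth_ffvals eqfg.
Qed.

Lemma sc_code_surj (S : pred nat) : \sum_(k < M) S k * (2 * k + 1) = N ->
  exists2 f, sc_code f & forall k, k < M -> frob M (nth 0 (ffvals f)) k = S k.
Proof.
have [l [lP lS]] := shape_exists M S.
under eq_bigr do rewrite -lS // ; rewrite -frob_size // => sz.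
have [l0 sym] := lP.
(* No row exceeds the total [N], and by symmetry there are at most [N] rows, so [l] fits the
   encoding. *)
have leN i : l i <= N.
  case: (ltnP i M) => [iM|/l0 ->] //.
  by rewrite -sz (bigD1 (Ordinal iM)) //= leq_addr.
have lN i : N <= i -> l i = 0.
  by move=> Ni; have := sym i 0; have := leN 0; lia.
pose f : {ffun 'I_N -> 'I_N.+1} := [ffun i : 'I_N => inord (l i)].
have fl : nth 0 (ffvals f) =1 l.
  move=> i; case: (ltnP i N) => iN; last by rewrite lN // nth_ffvals_ge.
  by rewrite -[i]/(nat_of_ord (Ordinal iN)) nth_ffvals ffunE inordK ?ltnS.
have srt : sorted geq (ffvals f).
  by apply/(sortedP 0) => i _; rewrite /= !fl; apply: (shape_mono lP).
exists f; last first.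
  by move=> k kM; rewrite -lS //; apply: eq_existsb => i; rewrite fl.
apply/andP; split; last by apply/self_conjugateP => // i j; rewrite !fl.
by rewrite /encodes_partition srt sumn_ffvals; under eq_bigr do rewrite fl; apply/eqP.
Qed.

Lemma sc_code_hooks f t : sc_code f -> 0 < t ->
  n_hook t (posvals f) = hook_stat t M (frob M (nth 0 (ffvals f))).
Proof.
move=> sc t0; have lP := sc_code_shape sc.
case/andP: sc => /andP[srt _] sc; rewrite (@n_hook_posparts _ srt M) //.
  exact: frob_hooks.
by case: lP.
Qed.

End Encoding.

Lemma eq_hook_stat t M (S S' : pred nat) : S =1 S' -> hook_stat t M S = hook_stat t M S'.
Proof.
by move=> eqS; rewrite /hook_stat; congr (_ + 2 * _); apply: eq_bigr => k _; rewrite !eqS.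
Qed.

(** [I] codes the subsets of [[0, M)]. It stays abstract so that families of words, one word per
    residue class, can be substituted later. *)
Lemma sc_coefE (R : nzRingType) (x : R) (t N M : nat) (I : finType)
    (code : I -> pred nat) :
  0 < t -> N <= M ->
  (forall c k, code c k -> k < M) ->
  (forall c c', (forall k, k < M -> code c k = code c' k) -> c = c') ->
  (forall S : pred nat, exists c, forall k, k < M -> code c k = S k) ->
  sc_coef x t N =
  (\sum_(c | (\sum_(k < M) code c k * (2 * k + 1))%N == N)
     x ^+ hook_stat t M (code c))%R.
Proof.
move=> t0 leNM codeM code_inj code_surj.
pose S (f : {ffun 'I_N -> 'I_N.+1}) := frob M (nth 0 (ffvals f)).
have codeE f c : sc_code f -> (forall k, k < M -> code c k = S f k) -> code c =1 S f.
  move=> sc h k; case: (ltnP k M) => [/h //|Mk]; apply/idP/idP => [/codeM|].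
    by rewrite ltnNge Mk.
  by move/(frob_lt (sc_code_shape leNM sc)); rewrite ltnNge Mk.
have hP f : exists c, [forall k : 'I_M, code c k == S f k].
  by have [c cS] := code_surj (S f); exists c; apply/forallP => k; rewrite cS.
pose h f := xchoose (hP f).
have hE f k : k < M -> code (h f) k = S f k.
  by move=> kM; have /forallP/(_ (Ordinal kM))/eqP := xchooseP (hP f).
(* Inverse of [h] on the codes of weight [N]; there the default of [odflt] is never reached. *)
pose h' c := odflt [ffun=> ord0] [pick f | sc_code f && (h f == c)].
have h'P c : \sum_(k < M) code c k * (2 * k + 1) = N -> sc_code (h' c) /\ h (h' c) = c.
  move=> sz; rewrite /h'; case: pickP => [f /andP[? /eqP] //|none].
  have [f sc fS] := sc_code_surj leNM sz.
  have := none f; rewrite sc /= => /eqP []; apply: code_inj => k kM.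
  by rewrite hE // /S fS.
rewrite [RHS](reindex_onto h h'); last by move=> c /eqP /h'P [].
rewrite /sc_coef; apply: eq_big => f.
  apply/idP/idP => [sc|/andP[/eqP/h'P [sc _] /eqP <-] //].
  have sz : \sum_(k < M) code (h f) k * (2 * k + 1) = N.
    by rewrite -[RHS](sc_code_size leNM sc); apply: eq_bigr => k _; rewrite hE.
  rewrite sz eqxx /=; apply/eqP; have [sc' e] := h'P _ sz.
  by apply: (sc_code_inj leNM) => // k kM; rewrite -!/(S _ _) -!hE // e.
move=> sc; rewrite (sc_code_hooks leNM sc) //.
by rewrite (eq_hook_stat _ _ (codeE f _ sc (hE f))).
Qed.

Local Open Scope ring_scope.

(** * Words counted by starts of runs *)

Lemma sum_tuple_cons (A : nmodType) (T : finType) n (F : seq T -> A) :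
  \sum_(s : n.+1.-tuple T) F s = \sum_(a : T) \sum_(s : n.-tuple T) F (a :: s).
Proof.
rewrite pair_big /= (reindex (fun p : T * n.-tuple T => [tuple of p.1 :: p.2])) //=.
exists (fun s => (thead s, [tuple of behead s])) => [[a s] _|s _] /=.
  by congr pair; apply: val_inj.
by case/tupleP: s => a t; apply: val_inj; rewrite /= theadE.
Qed.

Lemma sum_tuple_rcons (A : nmodType) (T : finType) n (F : seq T -> A) :
  \sum_(s : n.+1.-tuple T) F s = \sum_(a : T) \sum_(s : n.-tuple T) F (rcons s a).
Proof.
elim: n F => [|n IH] F.
  rewrite sum_tuple_cons; apply: eq_bigr => a _; apply: eq_bigr => s _.
  by rewrite (tuple0 s).
rewrite sum_tuple_cons; under eq_bigr => a _ do rewrite (IH (fun s => F (a :: s))).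
rewrite exchange_big /=.
apply: eq_bigr => a _; rewrite (sum_tuple_cons _ (fun s => F (rcons s a))).
by apply: eq_bigr.
Qed.

Section Transfer.
Variables (A : comNzRingType) (Q y : A).

(* Site [j] of a word carries weight [z Q^j], times [y] when the letter there
   starts a run of [true]s; [b] is the letter preceding the word. *)
Fixpoint word_wt (z : A) (b : bool) (s : seq bool) : A :=
  if s is a :: s' then
    (if a then z * (if b then 1 else y) else 1) * word_wt (z * Q) a s'
  else 1.

Definition words_gf (b : bool) (z : A) (n : nat) : A :=
  \sum_(s : n.-tuple bool) word_wt z b s.

Lemma words_gf0 b z : words_gf b z 0 = 1.
Proof.
rewrite /words_gf (eq_bigr (fun=> 1)) => [|s _]; last by rewrite (tuple0 s).
by rewrite sumr_const card_tuple expn0.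
Qed.

Lemma words_gfS b z n : words_gf b z n.+1 =
  words_gf false (z * Q) n + z * (if b then 1 else y) * words_gf true (z * Q) n.
Proof.
rewrite /words_gf sum_tuple_cons big_bool /= addrC; congr (_ + _).
  by apply: eq_bigr => s _; rewrite mul1r.
by rewrite mulr_sumr; apply: eq_bigr.
Qed.

Lemma word_wt_rcons z b s a : word_wt z b (rcons s a) =
  word_wt z b s * (if a then z * Q ^+ size s * (if last b s then 1 else y) else 1).
Proof.
elim: s z b => [|c s IH] z b /=; first by rewrite expr0 mulr1 mulr1 mul1r.
by rewrite IH exprS -!mulrA.
Qed.

(** Growth at the right end: [E] carries the factor that a further [true] would receive, and is
    eliminated from two first-order relations. This recurrence in the length serves the two-sided
    words. *)
Lemma words_gf_rec b z n : words_gf b z n.+2 =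
  (1 + z * Q ^+ n.+1) * words_gf b z n.+1 + (y - 1) * (z * Q ^+ n.+1) * words_gf b z n.
Proof.
pose E n := \sum_(s : n.-tuple bool) word_wt z b s * (if last b s then 1 else y).
have TS k : words_gf b z k.+1 = words_gf b z k + z * Q ^+ k * E k.
  rewrite /words_gf sum_tuple_rcons big_bool /= addrC; congr (_ + _).
    by apply: eq_bigr => s _; rewrite word_wt_rcons mulr1.
  rewrite /E mulr_sumr; apply: eq_bigr => s _; rewrite word_wt_rcons size_tuple.
  by rewrite mulrCA.
have ES k : E k.+1 = y * words_gf b z k + z * Q ^+ k * E k.
  rewrite /E (sum_tuple_rcons _ (fun s => word_wt z b s * (if last b s then 1 else y))).
  rewrite big_bool /= addrC; congr (_ + _).
    rewrite mulr_sumr; apply: eq_bigr => s _.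
    by rewrite word_wt_rcons last_rcons mulr1 mulrC.
  rewrite mulr_sumr; apply: eq_bigr => s _; rewrite word_wt_rcons last_rcons size_tuple.
  by rewrite mulr1 mulrCA.
rewrite [LHS]TS ES; have -> : z * Q ^+ n * E n = words_gf b z n.+1 - words_gf b z n.
  by rewrite TS addrC addKr.
ring.
Qed.

(** Growth at the left end, by expanding the first letters: the functional equation of [K]. *)
Lemma words_gf_rec_cons z n : words_gf true z n.+2 =
  (1 + z) * words_gf true (z * Q) n.+1 + (y - 1) * (z * Q) * words_gf true (z * Q * Q) n.
Proof.
rewrite [LHS]words_gfS [words_gf false _ _]words_gfS.
rewrite [words_gf true (z * Q) _]words_gfS; ring.
Qed.

Lemma words_gf_falseE z n : words_gf false z n.+1 =
  words_gf true z n.+1 + (y - 1) * z * words_gf true (z * Q) n.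
Proof. rewrite !words_gfS; ring. Qed.

(* As [Q ^+ m = 0], [r n] plays the part of 1/(Q;Q)_n and [tailprod k] that of
   (-zQ^k;Q)_oo. *)
Section Closed.
Variables (m : nat) (z : A) (r : nat -> A).
Hypothesis Qm : Q ^+ m = 0.
Hypothesis r0 : r 0%N = 1.
Hypothesis rS : forall n, (1 - Q ^+ n.+1) * r n.+1 = r n.
Let u := y - 1.

Lemma expQ_ge k : (m <= k)%N -> Q ^+ k = 0.
Proof. by move=> mk; rewrite -(subnK mk) exprD Qm mulr0. Qed.

(** Used with an [F] containing [(1 - Q ^+ n) * r n]: this vanishes at 0 and lowers the index of
    [r], while [G m = 0] absorbs the cut-off. *)
Lemma sum_shift (F G : nat -> A) c : F 0%N = 0 -> (forall n, F n.+1 = c * G n) ->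
  G m = 0 -> \sum_(n < m.+1) F n = c * \sum_(n < m.+1) G n.
Proof.
move=> F0 FS Gm; rewrite big_ord_recl F0 add0r big_ord_recr /= Gm addr0 mulr_sumr.
by apply: eq_bigr => i _; rewrite FS.
Qed.

Definition tailprod (k : nat) : A := \prod_(k <= j < m) (1 + z * Q ^+ j).

Lemma tailprodS k : tailprod k = (1 + z * Q ^+ k) * tailprod k.+1.
Proof.
rewrite /tailprod; case: (ltnP k m) => km; first by rewrite big_ltn.
by rewrite expQ_ge // mulr0 addr0 mul1r !big_geq // ltnW.
Qed.

Let gf_true_term k n : A :=
  u ^+ n * z ^+ n * Q ^+ (k * n + n * n) * tailprod (k + n) * r n.

Definition gf_true k : A := \sum_(n < m.+1)
  u ^+ n * z ^+ n * Q ^+ (k * n + n * n) * tailprod (k + n) * r n.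

Definition gf_false k : A := \sum_(n < m.+1)
  u ^+ n * z ^+ n * Q ^+ (k * n + n * n.-1) * tailprod (k + n) * r n.

(** Termwise [(1 + z Q^(k+n)) - (1 + z Q^k) Q^n = 1 - Q^n], which sends [r n] to [r (n - 1)] and
    shifts the index. *)
Lemma gf_true_rec k :
  gf_true k = (1 + z * Q ^+ k) * gf_true k.+1 + u * z * Q ^+ k.+1 * gf_true k.+2.
Proof.
apply/eqP; rewrite addrC -subr_eq; apply/eqP.
rewrite /gf_true mulr_sumr -sumrB.
rewrite -(@sum_shift (fun n => u ^+ n * z ^+ n * Q ^+ (k * n + n * n) *
   tailprod (k + n).+1 * ((1 - Q ^+ n) * r n)) (gf_true_term k.+2)).
- apply: eq_bigr => n _; rewrite (tailprodS (k + n)) addSn mulSn exprD.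
  have -> : Q ^+ (n + k * n + n * n) = Q ^+ n * Q ^+ (k * n + n * n).
    by rewrite -addnA exprD.
  rewrite [Q ^+ (k * n + _)]exprD [Q ^+ (k + n)]exprD; ring.
- by rewrite expr0 subrr mul0r mulr0.
- move=> n; rewrite rS /gf_true_term.
  have -> : (k * n.+1 + n.+1 * n.+1 = k.+1 + (k.+2 * n + n * n))%N by lia.
  by rewrite addnS !addSn [Q ^+ (k.+1 + _)]exprD !exprS; ring.
- by rewrite /gf_true_term expQ_ge ?mulr0 ?mul0r //; nia.
Qed.

Lemma gf_true1 k : (m <= k)%N -> gf_true k = 1.
Proof.
move=> mk; rewrite /gf_true big_ord_recl big1 => [|i _].
  by rewrite /= r0 muln0 /tailprod addn0 big_geq // !expr0 addr0 !mulr1.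
rewrite expQ_ge ?mulr0 ?mul0r // (leq_trans mk) //.
  by apply: leq_trans (leq_addr _ _); rewrite leq_pmulr.
Qed.

(** As [n + k = m], the word stops where [Q ^+ m = 0] kills all further weights, so it stands for an
    infinite word. Both sides obey the same recurrence and agree for [n <= 1]. *)
Lemma words_gf_true n k : (n + k = m)%N -> words_gf true (z * Q ^+ k) n = gf_true k.
Proof.
elim/ltn_ind: n k => -[|[|n]] IH k nk.
- by rewrite words_gf0 gf_true1 // -nk.
- have [h1 h2] : (m <= k.+1)%N /\ (m <= k.+2)%N by lia.
  by rewrite words_gfS !words_gf0 gf_true_rec !gf_true1 // (expQ_ge h1) /=; ring.
have e1 : words_gf true (z * Q ^+ k * Q) n.+1 = gf_true k.+1.
  by rewrite -mulrA -exprSr; apply: IH; lia.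
have e2 : words_gf true (z * Q ^+ k * Q * Q) n = gf_true k.+2.
  by rewrite -[_ * Q ^+ k * Q]mulrA -exprSr -mulrA -exprSr; apply: IH; lia.
rewrite words_gf_rec_cons e1 e2 (gf_true_rec k) exprSr.
rewrite /u; ring.
Qed.

Lemma gf_false_true k : gf_false k = gf_true k + u * z * Q ^+ k * gf_true k.+1.
Proof.
apply/eqP; rewrite addrC -subr_eq; apply/eqP; rewrite /gf_false /gf_true -sumrB.
rewrite -(@sum_shift (fun n => u ^+ n * z ^+ n * Q ^+ (k * n + n * n.-1) *
   tailprod (k + n) * ((1 - Q ^+ n) * r n)) (gf_true_term k.+1)).
- apply: eq_bigr => n _.
  have -> : (k * n + n * n = n + (k * n + n * n.-1))%N by case: (nat_of_ord n); lia.
  by rewrite [Q ^+ (n + _)]exprD; ring.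
- by rewrite expr0 subrr mul0r mulr0.
- move=> n; rewrite rS /gf_true_term /=.
  have -> : (k * n.+1 + n.+1 * n = k + (k.+1 * n + n * n))%N by lia.
  by rewrite addnS !addSn [Q ^+ (k + _)]exprD !exprS; ring.
- by rewrite /gf_true_term expQ_ge ?mulr0 ?mul0r //; nia.
Qed.

Lemma words_gf_false n k : (n + k = m)%N -> words_gf false (z * Q ^+ k) n = gf_false k.
Proof.
move=> nk; rewrite gf_false_true; case: n nk => [|n] nk.
  by rewrite words_gf0 gf_true1 -?nk // (expQ_ge (k := k)) -?nk // mulr0 mul0r addr0.
rewrite words_gf_falseE (words_gf_true nk) -[z * _ * Q]mulrA -exprSr.
by rewrite (@words_gf_true n k.+1) ?mulrA // -nk; lia.
Qed.

(** Euler's identity for [(-u Q^(k+1); Q)_oo]: passing from [k + 1] to [k] multiplies both sides by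
    [1 + u Q^(k+1)], and both are 1 once [k >= m]. *)
Lemma euler_sum k :
  \sum_(n < m.+1) u ^+ n * Q ^+ (k * n + 'C(n.+1, 2)) * r n =
  \prod_(k <= j < m) (1 + u * Q ^+ j.+1).
Proof.
pose E k := \sum_(n < m.+1) u ^+ n * Q ^+ (k * n + 'C(n.+1, 2)) * r n.
have binE n : ('C(n.+1, 2) = n + 'C(n, 2))%N by rewrite binS bin1 addnC.
have Em k' : (m <= k')%N -> E k' = 1.
  move=> mk; rewrite /E big_ord_recl big1 => [|i _].
    by rewrite /= r0 muln0 !mul1r addr0.
  rewrite expQ_ge ?mulr0 ?mul0r // (leq_trans mk) //.
    by apply: leq_trans (leq_addr _ _); rewrite leq_pmulr.
have ES k' : E k' = (1 + u * Q ^+ k'.+1) * E k'.+1.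
  rewrite mulrDl mul1r addrC; apply/eqP; rewrite -subr_eq; apply/eqP.
  rewrite /E -sumrB -(@sum_shift (fun n => u ^+ n * Q ^+ (k' * n + 'C(n.+1, 2)) *
     ((1 - Q ^+ n) * r n))
     (fun n => u ^+ n * Q ^+ (k'.+1 * n + 'C(n.+1, 2)) * r n)) //.
  - by apply: eq_bigr => n _; rewrite mulSn -addnA [Q ^+ (n + _)]exprD; ring.
  - by rewrite expr0 subrr mul0r mulr0.
  - move=> n; rewrite rS /gf_true_term.
    have -> : (k' * n.+1 + 'C(n.+2, 2) = k'.+1 + (k'.+1 * n + 'C(n.+1, 2)))%N.
      by rewrite (binE n.+1); lia.
    by rewrite [Q ^+ (k'.+1 + _)]exprD !exprS; ring.
  - by rewrite expQ_ge ?mulr0 ?mul0r // binE; nia.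
case: (leqP m k) => [mk|/ltnW km]; first by rewrite -/(E k) Em // big_geq.
rewrite -/(E k); move: km; rewrite -{1}(subnK (leq_subr k m)).
move: {-1}(m - k)%N (erefl (m - k)%N) => d; elim: d k => [|d IH] k e _.
  by rewrite Em ?big_geq //; lia.
by rewrite ES IH; [rewrite [RHS]big_ltn //| |]; lia.
Qed.

(** * Two-sided words: the factor of a pair of residue classes *)

Section Pair.
Variable z' : A.
Hypothesis zz' : z * z' = Q.

(* (-z;Q)_oo (-z';Q)_(N-n): for [N < n], (-z';Q)_(N-n) is the inverse of the
   product of the 1 + z' Q^(-i) = (1 + z Q^(i-1)) / (z Q^(i-1)), 1 <= i <= n - N,
   and is cleared against (-z;Q)_oo. *)
Definition half_prod (N n : nat) : A :=
  if (n <= N)%N then tailprod 0 * \prod_(0 <= j < N - n) (1 + z' * Q ^+ j)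
  else z ^+ (n - N) * Q ^+ 'C(n - N, 2) * tailprod (n - N).

Lemma half_prodSS N n : half_prod N.+1 n.+1 = half_prod N n.
Proof. by rewrite /half_prod ltnS subSS. Qed.

(** The step [(-z';Q)_(N+1-n) = (1 + z' Q^(N-n)) (-z';Q)_(N-n)], multiplied by [Q ^+ n] to avoid
    negative exponents. For [n > N] the relation [z * z' = Q] makes the two expressions match. *)
Lemma half_prodS N n : Q ^+ n * half_prod N.+1 n = (Q ^+ n + z' * Q ^+ N) * half_prod N n.
Proof.
rewrite /half_prod; case: (leqP n N) => nN.
  rewrite leqW // subSn // big_nat_recr //= mulrA mulrA.
  rewrite -[in z' * Q ^+ N](subnK nN) exprD; ring.
have [k nE] : exists k, (n = k.+1 + N)%N by exists (n - N).-1; lia.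
have -> : (if (n <= N.+1)%N then tailprod 0 * \prod_(0 <= j < N.+1 - n) (1 + z' * Q ^+ j)
   else z ^+ (n - N.+1) * Q ^+ 'C(n - N.+1, 2) * tailprod (n - N.+1)) =
   z ^+ k * Q ^+ 'C(k, 2) * tailprod k.
  case: (leqP n N.+1) => nN1; last by have -> : (n - N.+1 = k)%N by lia.
  have -> : k = 0%N by lia.
  by rewrite !expr0 !mul1r (_ : N.+1 - n = 0)%N ?big_geq ?mulr1 //; lia.
have -> : (n - N = k.+1)%N by lia.
rewrite (tailprodS k) binS bin1 nE addSn !exprS !exprD.
by move: (Q ^+ k) (Q ^+ N) (Q ^+ 'C(k, 2)) => a b c; rewrite -zz'; ring.
Qed.

(** Interpolates between the one-sided count at [N = 0] and, at [N = m], a sum that Euler's identity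
    evaluates. By [pair_gfS] and [half_prodSS] it satisfies the recurrence [words_gf_rec] for
    [z']. *)
Definition pair_gf N : A :=
  \sum_(n < m.+1) u ^+ n * Q ^+ 'C(n.+1, 2) * r n * half_prod N n.

Lemma pair_gfS N : pair_gf N.+1 = (1 + z' * Q ^+ N) * pair_gf N + u * (z' * Q ^+ N) *
  \sum_(n < m.+1) u ^+ n * Q ^+ 'C(n.+1, 2) * r n * half_prod N n.+1.
Proof.
have binE n : ('C(n.+1, 2) = n + 'C(n, 2))%N by rewrite binS bin1 addnC.
apply/eqP; rewrite addrC -subr_eq; apply/eqP; rewrite /pair_gf mulr_sumr -sumrB.
rewrite -(@sum_shift (fun n => u ^+ n * Q ^+ 'C(n, 2) * (z' * Q ^+ N) *
   ((1 - Q ^+ n) * r n) * half_prod N n)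
   (fun n => u ^+ n * Q ^+ 'C(n.+1, 2) * r n * half_prod N n.+1)).
- apply: eq_bigr => n _; rewrite binE exprD.
  transitivity (u ^+ n * Q ^+ 'C(n, 2) * r n * (Q ^+ n * half_prod N.+1 n) -
    u ^+ n * Q ^+ 'C(n, 2) * r n * Q ^+ n * (1 + z' * Q ^+ N) * half_prod N n).
    by ring.
  by rewrite half_prodS; ring.
- by rewrite expr0 subrr mul0r mulr0 mul0r.
- by move=> n; rewrite rS !exprS; ring.
- by rewrite expQ_ge ?mulr0 ?mul0r // binE; lia.
Qed.

Lemma pair_gf0 : pair_gf 0 = gf_true 0.
Proof.
apply: eq_bigr => -[n nm] _ /=.
have -> : half_prod 0 n = z ^+ n * Q ^+ 'C(n, 2) * tailprod n.
  by rewrite /half_prod leqn0 subn0; case: n {nm} => //=; rewrite big_geq // !mul1r mulr1.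
have -> : (0 * n + n * n = 'C(n.+1, 2) + 'C(n, 2))%N.
  elim: n {nm} => // n IH; have e : 'C(n.+1, 2) = ('C(n, 2) + n)%N by rewrite binS bin1.
  by rewrite binS bin1; lia.
by rewrite exprD add0n; ring.
Qed.

Lemma pair_gf1 : pair_gf 1 = gf_true 0 + z' * gf_false 0.
Proof.
rewrite pair_gfS pair_gf0 gf_false_true expr0 !mulr1.
have -> : \sum_(n < m.+1) u ^+ n * Q ^+ 'C(n.+1, 2) * r n * half_prod 0 n.+1 =
    z * gf_true 1.
  rewrite mulr_sumr; apply: eq_bigr => -[n nm] _ /=; rewrite /half_prod /= subn0 add1n.
  have -> : (1 * n + n * n = 'C(n.+1, 2) + 'C(n.+1, 2))%N.
    by elim: n {nm} => // n IH; rewrite binS bin1; lia.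
  by rewrite exprD exprS; ring.
ring.
Qed.

Lemma pair_gf_m : pair_gf m =
  tailprod 0 * \prod_(0 <= j < m) (1 + z' * Q ^+ j) *
  \prod_(0 <= j < m) (1 + u * Q ^+ j.+1).
Proof.
rewrite -euler_sum mulr_sumr; apply: eq_bigr => -[n nm] _ /=.
rewrite /half_prod -ltnS nm mul0n add0n.
(* The factors with [j >= m - n] may be restored: ['C(n.+1, 2) >= n], so [Q ^+ 'C(n.+1, 2)]
   annihilates [Q ^+ j]. *)
suff h : Q ^+ 'C(n.+1, 2) * \prod_(0 <= j < m - n) (1 + z' * Q ^+ j) =
    Q ^+ 'C(n.+1, 2) * \prod_(0 <= j < m) (1 + z' * Q ^+ j).
  transitivity (u ^+ n * r n * tailprod 0 *
    (Q ^+ 'C(n.+1, 2) * \prod_(0 <= j < m - n) (1 + z' * Q ^+ j))); first by ring.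
  by rewrite h; ring.
have e : Q ^+ 'C(n.+1, 2) * \prod_(m - n <= j < m) (1 + z' * Q ^+ j) =
    Q ^+ 'C(n.+1, 2).
  rewrite big_nat_cond; apply: (big_ind (fun x => Q ^+ 'C(n.+1, 2) * x = _)).
  - by rewrite mulr1.
  - by move=> a b ea eb; rewrite mulrA ea eb.
  move=> j /andP[/andP[jn _] _].
  rewrite mulrDr mulr1 mulrCA -exprD (@expQ_ge ('C(n.+1, 2) + j)) ?mulr0 ?addr0 //.
  by rewrite binS bin1; lia.
by rewrite [in RHS](big_cat_nat (n := m - n)) ?leq_subr //= [RHS]mulrCA e mulrC.
Qed.

(** The two products separate the letter at the origin. Both sides satisfy the same second-order
    recurrence in [N], so [N = 0] and [N = 1] suffice. *)
Lemma words_gf_pair m' N : m = m'.+1 ->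
  words_gf false (z * Q) m' * words_gf true z' N +
  z * words_gf true (z * Q) m' * words_gf false z' N =
  pair_gf N.
Proof.
move=> mE; elim/ltn_ind: N => -[|[|N]] IH.
- rewrite !words_gf0 pair_gf0 -(@words_gf_true m 0) ?addn0 //.
  rewrite expr0 !mulr1 mE words_gfS /= ?mulr1; ring.
- rewrite !words_gfS !words_gf0 pair_gf1 -(@words_gf_true m 0) ?addn0 //.
  rewrite -(@words_gf_false m 0) ?addn0 // expr0 !mulr1 mE !words_gfS /=; ring.
rewrite !words_gf_rec pair_gfS; under eq_bigr do rewrite half_prodSS.
rewrite -/(pair_gf N) -(IH N.+1) // -(IH N) //; rewrite /u; ring.
Qed.

Lemma word_wt_false x s :
  word_wt x false s = word_wt x true s * (if nth false s 0 then y else 1).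
Proof. by case: s => [|[] s] /=; ring. Qed.

(* Two-sided words: [p.1] is read rightwards from the origin, and [p.2]
   describes the complement of the word read leftwards. *)
Lemma pair_closed : (0 < m)%N ->
  \sum_(p : m.-tuple bool * m.-tuple bool)
     word_wt z true p.1 * word_wt z' true p.2 *
     (if nth false p.1 0 && nth false p.2 0 then y else 1) =
  tailprod 0 * \prod_(0 <= j < m) (1 + z' * Q ^+ j) *
  \prod_(0 <= j < m) (1 + u * Q ^+ j.+1).
Proof.
move=> m0; have mE : m = m.-1.+1 by rewrite prednK.
rewrite -pair_gf_m -(words_gf_pair _ mE).
rewrite -(pair_bigA _ (fun s s' : m.-tuple bool => word_wt z true s * word_wt z' true s' *
     (if nth false s 0 && nth false s' 0 then y else 1))) /=.
transitivity (\sum_(s : m.-tuple bool)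
  word_wt z true s * (if nth false s 0 then words_gf false z' m else words_gf true z' m)).
  apply: eq_bigr => s _; rewrite /words_gf; case: (nth false s 0) => /=.
    by rewrite mulr_sumr; apply: eq_bigr => s' _; rewrite word_wt_false mulrA.
  by rewrite mulr_sumr; apply: eq_bigr => s' _; rewrite mulr1.
move: (words_gf false z' m) (words_gf true z' m) => a b; rewrite mE.
rewrite (sum_tuple_cons _ (fun s => word_wt z true s * (if nth false s 0 then a else b))).
rewrite big_bool /= addrC /words_gf -mulr_suml; congr (_ + _).
  by congr (_ * _); apply: eq_bigr => s _; rewrite mul1r.
rewrite -mulr_suml mulr_sumr; congr (_ * _).
by apply: eq_bigr => s _; rewrite mulr1.
Qed.

End Pair.

(** An initial [true] carries [x]; multiplied by [x] it carries [y], as in [words_gf false]. Only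
    the words with initial [false] then differ, being counted [x] times instead of once. *)
Lemma mid_closed x : (0 < m)%N -> y = x * x ->
  x * \sum_(s : m.-tuple bool) word_wt z true s * (if nth false s 0 then x else 1) =
  (x - 1) * gf_false 1 + gf_false 0.
Proof.
move=> m0 yE; have mE : m = m.-1.+1 by rewrite prednK.
rewrite -(@words_gf_false m.-1 1) ?addn1 // -(@words_gf_false m 0) ?addn0 //.
rewrite expr1 expr0 mulr1 [X in words_gf false z X]mE.
pose F s := word_wt z true s * (if nth false s 0 then x else 1).
have -> : \sum_(s : m.-tuple bool) F s = \sum_(s : m.-1.+1.-tuple bool) F s.
  by rewrite -mE.
rewrite sum_tuple_cons /F.
rewrite big_bool /= -!mulr_suml.
have -> : \sum_(s : m.-1.-tuple bool) 1 * word_wt (z * Q) false s =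
    words_gf false (z * Q) m.-1.
  by apply: eq_bigr => s _; rewrite mul1r.
have -> : \sum_(s : m.-1.-tuple bool) z * 1 * word_wt (z * Q) true s =
    z * words_gf true (z * Q) m.-1.
  by rewrite mulr_sumr; apply: eq_bigr => s _; rewrite mulr1.
by rewrite words_gfS /= yE; ring.
Qed.

End Closed.
End Transfer.

(** * Splitting into residue classes *)

Section Residues.
Variables (h m : nat).
Let t := (2 * h + 1)%N.

Lemma prod_ord_mul (A : comNzRingType) (G : nat -> A) a n :
  \prod_(k < a * n) G k = \prod_(j < n) \prod_(i < a) G (i + a * j)%N.
Proof.
elim: n => [|n IH]; first by rewrite muln0 !big_ord0.
rewrite big_ord_recr -IH mulnS addnC big_split_ord /=; congr (_ * _).
by apply: eq_bigr => i _; rewrite addnC.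
Qed.

Lemma prod_ord_sym (A : comNzRingType) (G : nat -> A) :
  \prod_(i < t) G i = G h * \prod_(i < h) (G i * G (2 * h - i)%N).
Proof.
rewrite -(big_mkord xpredT) (big_cat_nat (n := h)) //=; last by rewrite /t; lia.
rewrite [X in _ * X]big_ltn; last by rewrite /t; lia.
rewrite mulrCA big_split /= big_mkord; congr (_ * (_ * _)).
rewrite big_nat_rev -[X in \prod_(X <= _ < _) _]add0n big_addn big_mkord.
have -> : (t - h.+1 = h)%N by rewrite /t; lia.
by apply: eq_bigr => i _; congr G; rewrite /t; have := ltn_ord i; lia.
Qed.

Lemma prod_residues (A : comNzRingType) (G : nat -> A) :
  \prod_(k < t * m) G k = \prod_(j < m) G (h + t * j)%N *
    \prod_(i < h) \prod_(j < m) (G (i + t * j)%N * G (2 * h - i + t * j)%N).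
Proof.
rewrite prod_ord_mul [X in _ * X]exchange_big -big_split /=.
by apply: eq_bigr => j _; rewrite (prod_ord_sym (fun r => G (r + t * j)%N)).
Qed.

Let word := m.-tuple bool.
Let codes := (word * {ffun 'I_h -> word * word})%type.

(** The classes [i] and [2h - i] read the two words of pair [i]; the default [[::]] does not occur
    for [r < t]. *)
Definition column (c : codes) (r : nat) : seq bool :=
  if r == h then tval c.1
  else if (r < h)%N then (if insub r is Some i then tval (c.2 i).1 else [::])
  else (if insub (2 * h - r)%N is Some i then tval (c.2 i).2 else [::]).

Definition code (c : codes) (k : nat) : bool :=
  nth false (column c (k %% t)) (k %/ t).

Lemma size_column c r : (size (column c r) <= m)%N.
Proof.
rewrite /column; case: ifP => _; first by rewrite size_tuple.
by case: ifP => _; case: insubP => [i _ _|_] //; rewrite size_tuple.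
Qed.

Lemma code_residue c r j : (r < t)%N -> code c (r + t * j)%N = nth false (column c r) j.
Proof.
move=> rt; rewrite /code addnC mulnC modnMDl modn_small // divnMDl ?divn_small ?addn0 //.
by rewrite /t addn1.
Qed.

Lemma column_mid c : column c h = c.1.
Proof. by rewrite /column eqxx. Qed.

Lemma column_low c (i : 'I_h) : column c i = (c.2 i).1.
Proof. by rewrite /column ltn_eqF // ltn_ord valK. Qed.

Lemma column_high c (i : 'I_h) : column c (2 * h - i)%N = (c.2 i).2.
Proof.
have := ltn_ord i => ih; rewrite /column gtn_eqF; last by lia.
rewrite ltnNge ltnW /=; last by lia.
have -> : (2 * h - (2 * h - i) = i)%N by lia.
by case: insubP => [j _ /val_inj ->|]; rewrite ?ih.
Qed.

Lemma code_lt c k : code c k -> (k < t * m)%N.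
Proof.
rewrite /code; case: (ltnP (k %/ t) m) => [|le].
  by rewrite ltn_divLR ?(mulnC m) // /t addn1.
by rewrite nth_default // (leq_trans (size_column _ _)).
Qed.

Lemma code_inj c c' :
  (forall k, (k < t * m)%N -> code c k = code c' k) -> c = c'.
Proof.
move=> eqc.
have eqcol r : (r < t)%N -> size (column c r) = m -> size (column c' r) = m ->
    column c r = column c' r.
  move=> rt s1 s2; apply: (@eq_from_nth _ false); rewrite s1 // => j jm.
  rewrite -!code_residue // eqc //.
  by rewrite -ltn_divLR ?(mulnC t) ?divnMDl; nia.
case: c c' eqc eqcol => [a f] [b g] eqc eqcol; congr pair.
  apply: val_inj => /=; have := eqcol h; rewrite !column_mid /= => -> //.
  - by rewrite /t; lia.
  - by rewrite size_tuple.
  - by rewrite size_tuple.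
apply/ffunP => i; have ih := ltn_ord i.
have := eqcol i; have := eqcol (2 * h - i)%N; rewrite !column_high !column_low /=.
rewrite !size_tuple => e2 e1; case: (f i) (g i) e1 e2 => [p q] [p' q'] /= e1 e2.
by congr pair; apply: val_inj => /=; [apply: e1|apply: e2] => //; rewrite /t; lia.
Qed.

Lemma code_surj (S : pred nat) : exists c, forall k, (k < t * m)%N -> code c k = S k.
Proof.
pose w r : word := [tuple S (r + t * j)%N | j < m].
exists (w h, [ffun i : 'I_h => (w i, w (2 * h - i)%N)]) => k km.
have t0 : (0 < t)%N by rewrite /t addn1.
have gf_true_term : (k %% t < t)%N by rewrite ltn_mod.
have kd : (k %/ t < m)%N by rewrite ltn_divLR // mulnC.
have colE r : (r < t)%N ->
    column (w h, [ffun i : 'I_h => (w i, w (2 * h - i)%N)]) r = w r.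
  move=> rt; rewrite /column; case: eqP => [->|/eqP ne] //.
  case: ltnP => hr; first by case: insubP => [i _ <-|]; rewrite ?ffunE ?hr.
  case: insubP => [i _ iE|]; last by rewrite /t in rt; lia.
  by rewrite ffunE /= iE; congr (tval (w _)); rewrite /t in rt; lia.
rewrite /code colE // /w -(tnth_nth false _ (Ordinal kd)) tnth_mktuple /=.
by rewrite addnC mulnC -divn_eq.
Qed.

Section Weight.
Variables (A : comNzRingType) (x q : A).

(** Site [j] of class [r] is the arm [r + t j], of weight [q^(2r+1) (q^(2t))^j], and [2h + 1 = t].
    The letter before the word is taken as [true] because site 0 has no predecessor in [hook_stat];
    the extra [x] is the term [k = h] of its first sum. *)
Definition mid_weight (s : seq bool) : A :=
  word_wt (q ^+ (2 * t)) (x * x) (q ^+ t) true s * (if nth false s 0 then x else 1).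

(** The terms [k = i] and [k = 2h - i] of the first sum in [hook_stat] coincide, hence [x * x]. *)
Definition pair_weight (i : nat) (p : word * word) : A :=
  word_wt (q ^+ (2 * t)) (x * x) (q ^+ (2 * i + 1)) true p.1 *
  word_wt (q ^+ (2 * t)) (x * x) (q ^+ (2 * (2 * h - i) + 1)) true p.2 *
  (if nth false p.1 0 && nth false p.2 0 then x * x else 1).

(** A run starting at site [j + 1] is charged to site [j]; letters past the end read as [false] and
    contribute 1. *)
Lemma word_wtE (Q y z : A) b s n : (size s <= n)%N ->
  word_wt Q y z b s = (if ~~ b && nth false s 0 then y else 1) *
  \prod_(j < n) ((if nth false s j then z * Q ^+ j else 1) *
                (if ~~ nth false s j && nth false s j.+1 then y else 1)).
Proof.
elim: n z b s => [|n IH] z b [|a s] //= sn.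
- by rewrite andbF big_ord0 mulr1.
- rewrite andbF mul1r big1 // => i _; rewrite nth_nil.
  by case: (nat_of_ord i) => [|k] /=; rewrite ?nth_nil mulr1.
rewrite (IH _ a) // big_ord_recl /= expr0 mulr1.
under [in RHS]eq_bigr => i _ do rewrite /= exprS mulrA.
by case: a; case: b => /=; ring.
Qed.

Lemma column_weight c r : (r < t)%N ->
  \prod_(j < m) ((x * x) ^+ (~~ code c (r + t * j)%N && code c (r + t * j + t)%N) *
    q ^+ (code c (r + t * j)%N * (2 * (r + t * j) + 1))) =
  word_wt (q ^+ (2 * t)) (x * x) (q ^+ (2 * r + 1)) true (column c r).
Proof.
move=> rt; rewrite (word_wtE _ _ _ _ (size_column c r)) mul1r.
apply: eq_bigr => j _; rewrite -addnA -mulnSr !code_residue // mulrC; congr (_ * _).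
  case: (nth false _ j); rewrite ?mul0n ?mul1n // -exprM -exprD; congr (_ ^+ _); lia.
by case: (_ && _); rewrite ?expr1 ?expr0.
Qed.

Lemma code_weight c :
  x ^+ hook_stat t (t * m) (code c) * q ^+ (\sum_(k < t * m) code c k * (2 * k + 1)) =
  mid_weight c.1 * \prod_(i < h) pair_weight i (c.2 i).
Proof.
pose G k := (x * x) ^+ (~~ code c k && code c (k + t)%N) * q ^+ (code c k * (2 * k + 1)).
pose B k := x ^+ (code c k && code c (t.-1 - k)%N).
have code0 r : (r < t)%N -> code c r = nth false (column c r) 0.
  by move=> rt; rewrite -code_residue // muln0 addn0.
transitivity (\prod_(k < t) B k * \prod_(k < t * m) G k).
  rewrite /G big_split /= !prodrXr /hook_stat exprD exprM expr2 -!mulrA.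
  by [].
rewrite prod_residues prod_ord_sym.
have -> : B h = if nth false c.1 0 then x else 1.
  rewrite /B (_ : t.-1 - h = h)%N; last by rewrite /t; lia.
  by rewrite code0 ?column_mid ?andbb; [case: (nth _ _ _) | rewrite /t; lia].
have -> : \prod_(j < m) G (h + t * j)%N =
    word_wt (q ^+ (2 * t)) (x * x) (q ^+ t) true c.1.
  by rewrite column_weight ?column_mid // /t; lia.
rewrite mulrACA [X in X * _]mulrC; congr (_ * _); rewrite -big_split /=.
apply: eq_bigr => i _; have ih := ltn_ord i.
have it : (i < t)%N by rewrite /t; lia.
have i't : (2 * h - i < t)%N by rewrite /t; lia.
rewrite big_split /= !column_weight // column_low column_high mulrC; congr (_ * _).
rewrite /B (_ : t.-1 - i = 2 * h - i)%N; last by rewrite /t; lia.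
rewrite (_ : t.-1 - (2 * h - i) = i)%N; last by rewrite /t; lia.
rewrite !code0 // column_low column_high andbC.
by case: (_ && _); rewrite ?expr1 ?expr0 ?mul1r.
Qed.

Lemma gf_factor :
  \sum_(c : codes)
    x ^+ hook_stat t (t * m) (code c) * q ^+ (\sum_(k < t * m) code c k * (2 * k + 1)) =
  (\sum_(s : word) mid_weight s) *
  \prod_(i < h) \sum_(p : word * word) pair_weight i p.
Proof.
rewrite bigA_distr_bigA big_distrl /=.
under [RHS]eq_bigr do rewrite big_distrr /=.
by rewrite pair_bigA; apply: eq_bigr => c _; exact: code_weight.
Qed.

End Weight.
End Residues.

(** * Power series at a nilpotent element *)

Section Series.
Variable R : fieldType.
Implicit Types (f g : fps R) (F : nat -> fps R).

Lemma nth_inv_rev f n i : (i <= n)%N -> nth 0 (inv_rev f n) i = fps_inv f (n - i)%N.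
Proof.
elim: n i => [|n IH] [|i] //; try by rewrite subn0 /fps_inv; case: n {IH}.
by move=> in_; rewrite /= IH.
Qed.

Lemma fps_mul_inv f n : f 0%N != 0 -> fps_mul f (fps_inv f) n = fps_one R n.
Proof.
move=> f0; rewrite /fps_mul /fps_one; case: n => [|n].
  by rewrite big_ord_recl big_ord0 addr0 /fps_inv /= mulfV.
rewrite big_ord_recl /= subn0 [fps_inv f n.+1]/fps_inv /=.
rewrite mulrA mulrN mulfV // mulN1r addrC; apply/eqP; rewrite subr_eq0; apply/eqP.
by apply: eq_bigr => i _; rewrite subSS nth_inv_rev // -ltnS.
Qed.

Lemma fps_mono_mul_lt (c : R) k g i : (i < k)%N -> fps_mul (fps_mono c k) g i = 0.
Proof.
move=> ik; rewrite /fps_mul big1 // => j _; rewrite /fps_mono ltn_eqF ?mul0r //.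
by have := ltn_ord j; lia.
Qed.

Definition qpoch_poly (a : R) (e s n : nat) : {poly R} :=
  \prod_(j < n) (1 - a *: 'X^(e + s * j)).

Lemma qpochE a e s n i : qpoch a e s n i = (qpoch_poly a e s n)`_i.
Proof.
rewrite /qpoch /qpoch_poly -(big_mkord xpredT (fun j => 1 - a *: 'X^(e + s * j))).
rewrite /index_iota subn0; elim: (iota 0 n) i => [|j r IH] i.
  by rewrite big_nil /= coef1.
rewrite big_cons coefM /= /fps_mul; apply: eq_bigr => k _; rewrite IH; congr (_ * _).
rewrite /fps_add /fps_one /fps_mono coefB coef1 coefZ coefXn.
by case: (nat_of_ord k == (e + s * j)%N); rewrite ?mulr1 ?mulr0 ?oppr0.
Qed.

Lemma qpoch_infE a e s n i : (0 < s)%N -> (i < n)%N ->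
  qpoch_inf a e s i = (qpoch_poly a e s n)`_i.
Proof.
move=> s0; rewrite /qpoch_inf qpochE; elim: n => // n IH.
rewrite ltnS leq_eqVlt => /predU1P [-> //|lt_in].
rewrite IH // {2}/qpoch_poly big_ord_recr /= mulrBr mulr1 coefB -scalerAr coefZ coefMXn.
by rewrite ifT ?mulr0 ?subr0 //; nia.
Qed.

Section Eval.
Variables (A : comAlgType R) (p : A) (L : nat).
Hypothesis pL : p ^+ L = 0.

(** Since [p ^+ L = 0], the discarded coefficients cannot matter, so [ev] respects sums and products
    of series. *)
Definition ev (f : fps R) : A := horner_alg p (\poly_(i < L) f i).

Lemma ev_poly f (P : {poly R}) : (forall i, (i < L)%N -> f i = P`_i) ->
  ev f = horner_alg p P.
Proof.
move=> fP; rewrite /ev -[P in RHS](poly_take_drop L) rmorphD rmorphM rmorphXn /=.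
rewrite horner_algX pL mulr0 addr0; congr (horner_alg p _).
by apply/polyP => i; rewrite coef_poly coef_take_poly; case: ifP => // /fP.
Qed.

Lemma eq_ev f g : (forall i, (i < L)%N -> f i = g i) -> ev f = ev g.
Proof. by move=> fg; apply: ev_poly => i iL; rewrite coef_poly iL fg. Qed.

Lemma evM f g : ev (fps_mul f g) = ev f * ev g.
Proof.
rewrite /ev -rmorphM; apply: ev_poly => i iL; rewrite coefM; apply: eq_bigr => j _.
by have := ltn_ord j => ji; rewrite !coef_poly !ifT //; lia.
Qed.

Lemma evD f g : ev (fps_add f g) = ev f + ev g.
Proof. by rewrite /ev -rmorphD; apply: ev_poly => i iL; rewrite coefD !coef_poly iL. Qed.

Lemma horner_algZ c (P : {poly R}) : horner_alg p (c *: P) = c *: horner_alg p P.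
Proof. by rewrite linearZ /= mulr_algl. Qed.

Lemma evZ c f : ev (fps_scale c f) = c *: ev f.
Proof.
rewrite /ev -horner_algZ; apply: ev_poly => i iL.
by rewrite coefZ coef_poly iL.
Qed.

Lemma ev1 : ev (fps_one R) = 1.
Proof. by rewrite -(rmorph1 (horner_alg p)); apply: ev_poly => i _; rewrite coef1. Qed.

Lemma ev_mono c k : ev (fps_mono c k) = c *: p ^+ k.
Proof.
rewrite -[p in RHS]horner_algX -rmorphXn -horner_algZ; apply: ev_poly => i _ /=.
by rewrite coefZ coefXn /fps_mono; case: (i == k); rewrite ?mulr1 ?mulr0.
Qed.

Lemma ev_inv f : f 0%N != 0 -> ev (fps_inv f) * ev f = 1.
Proof.
move=> f0; rewrite mulrC -evM -ev1; apply: eq_ev => i _; exact: fps_mul_inv.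
Qed.

Lemma ev_pow f k : ev (fps_pow f k) = ev f ^+ k.
Proof. by elim: k => [|k IH]; rewrite ?ev1 // exprS -IH -evM. Qed.

Lemma ev_infsum F n : (forall k i, (i < k)%N -> F k i = 0) -> (L <= n)%N ->
  ev (fps_infsum F) = \sum_(k < n) ev (F k).
Proof.
move=> F0 Ln; rewrite -raddf_sum; apply: ev_poly => i iL.
rewrite coef_sum /fps_infsum; under [RHS]eq_bigr do rewrite coef_poly iL.
rewrite -!(big_mkord xpredT (fun k => F k i)) [RHS](big_cat_nat (n := i.+1)) //=.
  rewrite [X in _ = _ + X]big_nat_cond [X in _ = _ + X]big1 ?addr0 // => k.
  by case/andP=> /andP[ik _] _; exact: F0.
exact: leq_trans iL Ln.
Qed.

Lemma horner_alg_qpoch a e s n :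
  horner_alg p (qpoch_poly a e s n) = \prod_(j < n) (1 - a *: p ^+ (e + s * j)).
Proof.
rewrite rmorph_prod; apply: eq_bigr => j _.
by rewrite rmorphB rmorph1 /= horner_algZ rmorphXn /= horner_algX.
Qed.

Lemma ev_qpoch a e s n :
  ev (qpoch a e s n) = \prod_(j < n) (1 - a *: p ^+ (e + s * j)).
Proof. by rewrite -horner_alg_qpoch; apply: ev_poly => i _; apply: qpochE. Qed.

Lemma ev_qpoch_inf a e s n : (0 < s)%N -> (L <= n)%N ->
  ev (qpoch_inf a e s) = \prod_(j < n) (1 - a *: p ^+ (e + s * j)).
Proof.
move=> s0 Ln; rewrite -horner_alg_qpoch; apply: ev_poly => i iL.
by apply: qpoch_infE => //; exact: leq_trans iL Ln.
Qed.

End Eval.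

Lemma ev_subst_pow (A : comAlgType R) (p : A) L t f : (0 < t)%N -> p ^+ L = 0 ->
  ev p L (fps_subst_pow t f) = ev (p ^+ t) L f.
Proof.
move=> t0 pL.
have -> : ev p L (fps_subst_pow t f) = horner_alg p ((\poly_(i < L) f i) \Po 'X^t).
  apply: ev_poly => // i iL; rewrite coef_comp_poly_Xn // /fps_subst_pow.
  by case: ifP => // _; rewrite coef_poly ifT //; apply: leq_ltn_trans (leq_div _ _) iL.
rewrite /ev; elim/poly_ind: (\poly_(i < L) f i) => [|P c IH].
  by rewrite comp_poly0 !rmorph0.
rewrite comp_polyD comp_polyM comp_polyX comp_polyC !rmorphD !rmorphM /= IH.
by rewrite !horner_algC rmorphXn /= !horner_algX.
Qed.

Lemma qpolyX_nilp L : 'qX ^+ L.+1 = 0 :> {poly %/ ('X^(L.+1) : {poly R})}.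
Proof.
rewrite -rmorphXn; apply: val_inj; rewrite /= mk_monic_Xn.
exact: (Pdiv.RingMonic.rmodpp (monicXn _ _)).
Qed.

Lemma horner_alg_qpolyX L (P : {poly R}) :
  horner_alg ('qX : {poly %/ ('X^(L.+1) : {poly R})}) P = in_qpoly _ P.
Proof.
elim/poly_ind: P => [|P c IH]; first by rewrite !rmorph0.
rewrite !rmorphD !rmorphM /= IH horner_algC horner_algX; congr (_ + _).
by rewrite -[c%:P]mulr1 mul_polyC linearZ /= rmorph1.
Qed.

(** Modulo [X^(L+1)] a truncated series is its own remainder, so its coefficients can be read
    off. *)
Lemma ev_qpolyX_inj L (f g : fps R) i : (i <= L)%N ->
  ev ('qX : {poly %/ ('X^(L.+1) : {poly R})}) L.+1 f =
  ev ('qX : {poly %/ ('X^(L.+1) : {poly R})}) L.+1 g -> f i = g i.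
Proof.
move=> iL; rewrite /ev !horner_alg_qpolyX => /(congr1 val) /=.
have small (k : fps R) :
    Pdiv.CommonRing.rmodp (\poly_(i < L.+1) k i) (mk_monic 'X^(L.+1)) =
    \poly_(i < L.+1) k i.
  by rewrite Pdiv.CommonRing.rmodp_small // mk_monic_Xn size_polyXn ltnS size_poly.
rewrite !small => /(congr1 (fun P : {poly R} => P`_i)).
by rewrite !coef_poly ltnS iL.
Qed.

End Series.

(** * Evaluation of [Hstar] through the closed forms for one-sided words *)

Section HstarEval.
Variables (R : fieldType) (x : R) (A : comAlgType R) (p : A) (L m : nat).
Hypothesis pL : p ^+ L = 0.
Hypothesis Lm : (L <= m)%N.
Let Q := p ^+ 2.
Let y : A := x%:A * x%:A.
Let r n := ev p L (fps_inv (qpoch (1 : R) 2 2 n)).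

Let Qm : Q ^+ m = 0.
Proof. by rewrite -exprM (_ : 2 * m = (2 * m - L) + L)%N ?exprD ?pL ?mulr0 //; lia. Qed.

Let qpoch_const (a : R) e s n : (0 < e)%N -> qpoch a e s n 0 != 0.
Proof.
move=> e0; rewrite qpochE /qpoch_poly.
have -> : (\prod_(j < n) (1 - a *: 'X^(e + s * j)))`_0 = 1.
  elim: n => [|n IH]; first by rewrite big_ord0 coef1.
  rewrite big_ord_recr coefM big_ord_recl big_ord0 addr0 IH mul1r.
  by rewrite coefB coef1 coefZ coefXn /= eq_sym addn_eq0 eqn0Ngt e0 mulr0 subr0.
exact: oner_neq0.
Qed.

Let rE n : r n * \prod_(j < n) (1 - Q ^+ j.+1) = 1.
Proof.
rewrite /r -[RHS](ev_inv pL (qpoch_const 1 2 n (isT : 0 < 2)%N)) ev_qpoch //.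
congr (_ * _); apply: eq_bigr => j _; rewrite scale1r -exprM; congr (1 - _ ^+ _); lia.
Qed.

Lemma qinv0 : r 0 = 1.
Proof. by rewrite -[RHS](rE 0) big_ord0 mulr1. Qed.

Lemma qinvS n : (1 - Q ^+ n.+1) * r n.+1 = r n.
Proof.
have e1 := rE n; have := rE n.+1; rewrite big_ord_recr /=; set P := \prod_(j < n) _ => e2.
transitivity ((1 - Q ^+ n.+1) * r n.+1 * (r n * P)); first by rewrite e1 mulr1.
transitivity (r n.+1 * (P * (1 - Q ^+ n.+1)) * r n); first by ring.
by rewrite e2 mul1r.
Qed.

Lemma tailprod_split k :
  \prod_(j < k) (1 + p * Q ^+ j) * tailprod Q m p k = tailprod Q m p 0.
Proof.
elim: k => [|k IH]; first by rewrite big_ord0 mul1r.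
by rewrite big_ord_recr /= -mulrA -tailprodS.
Qed.

(** The first [k] factors of [(-p;Q)_oo] cancel the inverse of [(-p;Q)_k], leaving the tail. *)
Lemma tail_inv n k :
  tailprod Q m p 0 *
    ev p L (fps_inv (fps_mul (qpoch 1 2 2 n) (qpoch (-1) 1 2 k))) =
  tailprod Q m p k * r n.
Proof.
set f := qpoch 1 2 2 n; set g := qpoch (-1) 1 2 k.
have f0 : f 0%N != 0 by apply: qpoch_const.
have g0 : g 0%N != 0 by apply: qpoch_const.
have fg0 : fps_mul f g 0%N != 0.
  by rewrite /fps_mul big_ord_recl big_ord0 addr0 mulf_neq0.
have evg : ev p L g = \prod_(j < k) (1 + p * Q ^+ j).
  rewrite /g ev_qpoch //; apply: eq_bigr => j _.
  by rewrite scaleN1r opprK -exprM exprD expr1.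
rewrite -(tailprod_split k) -evg; have := ev_inv pL fg0; have := ev_inv pL f0.
rewrite evM // /r -/f; set J := ev p L (fps_inv f).
set I := ev p L (fps_inv (fps_mul f g)) => Jf Ifg.
transitivity (tailprod Q m p k * (J * ev p L f) * (ev p L g * I)).
  by rewrite Jf; ring.
transitivity (tailprod Q m p k * J * (I * (ev p L f * ev p L g))); first by ring.
by rewrite Ifg mulr1.
Qed.

Lemma ev_theta_sum (c : R) (e k : nat -> nat) : (forall n, (n <= e n)%N) ->
  tailprod Q m p 0 * ev p L (fps_infsum (fun n =>
    fps_mul (fps_mono (c ^+ n) (e n))
      (fps_inv (fps_mul (qpoch 1 2 2 n) (qpoch (-1) 1 2 (k n)))))) =
  \sum_(n < m.+1) c%:A ^+ n * p ^+ e n * tailprod Q m p (k n) * r n.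
Proof.
move=> le_e; set F := fun n : nat => _.
have Flt n i : (i < n)%N -> F n i = 0.
  by move=> i_n; apply: fps_mono_mul_lt; apply: leq_trans (le_e n).
rewrite (ev_infsum pL Flt (n := m.+1) (leqW Lm)) mulr_sumr; apply: eq_bigr => n _.
rewrite /F evM // ev_mono // mulrCA tail_inv -[c%:A]/(in_alg A c) -rmorphXn /=.
by rewrite mulr_algl -!scalerAl mulrA.
Qed.

(** With [z = p] and [Q = p ^+ 2], the exponents are [2n^2 + n = n + 2(n + n(n-1))] and
    [2n^2 - n = n + 2n(n-1)]: the cases [k = 1] and [k = 0] of [gf_false]. *)
Lemma ev_Hstar : tailprod Q m p 0 * ev p L (Hstar x) =
  (1 - x^-1) *: gf_false Q y m p r 1 + x^-1 *: gf_false Q y m p r 0.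
Proof.
have uE : y - 1 = (x ^+ 2 - 1)%:A.
  by rewrite -[RHS]/(in_alg A _) rmorphB rmorph1 rmorphXn /= expr2.
rewrite /Hstar evD // !evZ // mulrDr -!scalerAr.
rewrite (@ev_theta_sum _ (fun n => 2 * n ^ 2 + n)%N succn); last by move=> n; lia.
rewrite (@ev_theta_sum _ (fun n => 2 * n ^ 2 - n)%N id); last by case=> // n; lia.
congr (_ *: _ + _ *: _); apply: eq_bigr => -[n nm] _ /=; rewrite uE.
  have -> : p ^+ (2 * n ^ 2 + n) = p ^+ n * Q ^+ (1 * n + n * n.-1).
    by rewrite -exprM -exprD; congr (_ ^+ _); case: n {nm} => //= n; lia.
  by rewrite add1n !mulrA.
have -> : p ^+ (2 * n ^ 2 - n) = p ^+ n * Q ^+ (0 * n + n * n.-1).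
  by rewrite -exprM -exprD; congr (_ ^+ _); case: n {nm} => //= n; lia.
by rewrite !mulrA.
Qed.
End HstarEval.

(** * Assembly *)

Section Assembly.
Variables (R : fieldType) (x : R) (A : comAlgType R) (q : A) (L m h : nat).
Hypothesis qL : q ^+ L = 0.
Hypothesis Lm : (L <= m)%N.
Hypothesis m0 : (0 < m)%N.
Hypothesis x0 : x != 0.
Let t := (2 * h + 1)%N.
Let Q := q ^+ (2 * t).
Let y : A := x%:A * x%:A.

Lemma exp_nilp k : (0 < k)%N -> (q ^+ k) ^+ L = 0.
Proof. by move=> k0; rewrite -exprM mulnC exprM qL expr0n; case: k k0. Qed.

Lemma expQm : Q ^+ m = 0.
Proof. by rewrite -(subnK Lm) exprD exp_nilp ?mulr0 // /t; lia. Qed.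

Let r n := ev (q ^+ t) L (fps_inv (qpoch (1 : R) 2 2 n)).

Let t0 : (0 < t)%N. Proof. by rewrite /t addn1. Qed.

Let QE : Q = (q ^+ t) ^+ 2. Proof. by rewrite /Q mulnC exprM. Qed.

Let r0 : r 0%N = 1. Proof. exact: (qinv0 (exp_nilp t0) Lm). Qed.

Let rS n : (1 - Q ^+ n.+1) * r n.+1 = r n.
Proof. by rewrite QE; apply: (qinvS (exp_nilp t0) Lm). Qed.

(** Dividing [mid_closed] by [x] produces the coefficients [1 - x^-1] and [x^-1] of [Hstar]. *)
Lemma mid_sum : \sum_(s : m.-tuple bool) mid_weight h x%:A q s =
  tailprod Q m (q ^+ t) 0 * ev q L (fps_subst_pow t (Hstar x)).
Proof.
rewrite ev_subst_pow // QE (ev_Hstar x (exp_nilp t0) Lm) -QE.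
have M := mid_closed (q ^+ t) expQm r0 rS m0 (erefl y).
transitivity (x^-1 *: (x%:A * \sum_(s : m.-tuple bool) mid_weight h x%:A q s)).
  by rewrite mulr_algl scalerA mulVf // scale1r.
rewrite M; move: (gf_false _ _ _ _ _ 1) (gf_false _ _ _ _ _ 0) => P1 P0.
rewrite mulrBl mul1r mulr_algl scalerDr scalerBr scalerA mulVf // scale1r.
by rewrite scalerBl scale1r.
Qed.

Lemma pair_sum (i : 'I_h) :
  \sum_(p : m.-tuple bool * m.-tuple bool) pair_weight h x%:A q i p =
  \prod_(j < m) ((1 + q ^+ (2 * i + 1) * Q ^+ j) *
                 (1 + q ^+ (2 * (2 * h - i) + 1) * Q ^+ j)) *
  \prod_(j < m) (1 + (y - 1) * Q ^+ j.+1).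
Proof.
have ih := ltn_ord i; rewrite /pair_weight (pair_closed _ expQm r0 rS _ m0).
  by rewrite /tailprod !big_mkord big_split.
(* The relation [z * z' = Q]: [(2i + 1) + (2(2h - i) + 1) = 2t]. *)
by rewrite -exprD; congr (_ ^+ _); lia.
Qed.

Lemma gf_eval :
  \sum_(c : m.-tuple bool * {ffun 'I_h -> m.-tuple bool * m.-tuple bool})
    x%:A ^+ hook_stat t (t * m) (code c) *
      q ^+ (\sum_(k < t * m) code c k * (2 * k + 1)) =
  ev q L (fps_mul (fps_mul (qpoch_inf (-1) 1 2) (fps_subst_pow t (Hstar x)))
    (fps_pow (qpoch_inf (1 - x ^+ 2) (2 * t) (2 * t)) h)).
Proof.
rewrite gf_factor mid_sum !evM // ev_pow //.
rewrite (@ev_qpoch_inf _ _ _ _ qL _ _ _ (t * m)) //; last first.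
  by rewrite (leq_trans Lm) ?leq_pmull.
rewrite (@ev_qpoch_inf _ _ _ _ qL _ _ _ m) ?muln_gt0 //.
(* [(-q;q^2)_oo] is split over the same classes: class [h] gives the [tailprod] of [mid_sum], each
   pair its two products. The [h] Euler products left over form the power. *)
rewrite (prod_residues h m (fun k => 1 - (-1) *: q ^+ (1 + 2 * k))).
have facE a j : 1 - (-1) *: q ^+ (1 + 2 * (a + t * j)) = 1 + q ^+ (2 * a + 1) * Q ^+ j.
  by rewrite scaleN1r opprK -exprM -exprD; congr (_ + _ ^+ _); lia.
have eulE j : 1 - (1 - x ^+ 2) *: q ^+ (2 * t + 2 * t * j) = 1 + (y - 1) * Q ^+ j.+1.
  have -> : y - 1 = (x ^+ 2 - 1)%:A.
    by rewrite -[RHS]/(in_alg A _) rmorphB rmorph1 rmorphXn /= expr2.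
  by rewrite mulr_algl -scaleNr opprB -exprM mulnSr addnC mulnC.
under [X in _ = X * _ * _ * _]eq_bigr do rewrite facE.
under [X in _ = _ * X ^+ h]eq_bigr do rewrite eulE.
rewrite [RHS]mulrAC -[LHS]mulrA -[RHS]mulrA /tailprod big_mkord.
rewrite -[X in _ = X]mulrA; congr (_ * _); rewrite mulrC mulrA; congr (_ * _).
rewrite -[h in X in _ = _ * X]card_ord -prodr_const -big_split /=.
apply: eq_bigr => i _; rewrite pair_sum; congr (_ * _).
by apply: eq_bigr => j _; rewrite !facE.
Qed.

End Assembly.

Theorem theorem1p1 (R : fieldType) (t : nat) (x : R) :
  odd t -> x != 0 ->
  forall N : nat,
    sc_coef x t N =
    fps_mul
      (fps_mul (qpoch_inf (-1) 1 2) (fps_subst_pow t (Hstar x)))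
      (fps_pow (qpoch_inf (1 - x ^+ 2) (2 * t) (2 * t)) ((t - 1) %/ 2))
      N.
Proof.
move=> t_odd x0 N; have [h ->] : exists h, t = (2 * h + 1)%N.
  by exists t./2; rewrite -[LHS]odd_double_half t_odd -mul2n addnC.
rewrite addnK mulKn //; move: t {t_odd} => _; set t := (2 * h + 1)%N.
(* Words of length [N + 1] cover all arms below [t * m], enough for size [N], and reach the order at
   which [X] is nilpotent. *)
pose m := N.+1; pose stat c := hook_stat t (t * m) (@code h m c).
pose wgt c := (\sum_(k < t * m) @code h m c k * (2 * k + 1))%N.
pose g n := \sum_(c | wgt c == n) x ^+ stat c.
have t0 : (0 < t)%N by rewrite /t addn1.
have -> : sc_coef x t N = g N.
  apply: sc_coefE => //; first by rewrite (leq_trans (leqnSn N)) ?leq_pmull.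
  - exact: code_lt.
  - exact: code_inj.
  - exact: code_surj.
pose X : {poly %/ ('X^(N.+1) : {poly R})} := 'qX.
have XL : X ^+ N.+1 = 0 := qpolyX_nilp R N.
apply: (ev_qpolyX_inj (leqnn N)); rewrite -/X -(gf_eval h XL (leqnn _)) //.
(* [g] lists the coefficients of a polynomial summed over all codes; its value at [X] is the left
   side of [gf_eval]. *)
transitivity (horner_alg X (\sum_c x ^+ stat c *: 'X^(wgt c))).
  apply: ev_poly => // i _; rewrite coef_sum /g big_mkcond; apply: eq_bigr => c _.
  by rewrite coefZ coefXn eq_sym; case: eqP; rewrite ?mulr1 ?mulr0.
rewrite raddf_sum; apply: eq_bigr => c _.
rewrite /= horner_algZ rmorphXn /= horner_algX -mulr_algl; congr (_ * _).
by rewrite -[LHS]/(in_alg _ _) rmorphXn.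
Qed.
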